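(* Let $q$ be a power of a prime. For any multiplicative characters $A,A',B,B',C$ of $\mathbb{F}_q^*$ and any $x,y\in\mathbb{F}_q$, \begin{align*} F_{3}(A,A';B,B';C;x,y)&=\frac{1}{(q-1)^2}\sum_{\chi,\lambda}\binom{\overline{A}}{\chi}\binom{\overline{A'}}{\lambda}\binom{C\overline{B}\,\overline{B'}}{C\chi\lambda}\binom{\overline{B}\,\overline{B'}\,\overline{\chi}\,\overline{\lambda}}{\overline{B'}\,\overline{\lambda}}\chi(x)\lambda(y)\\ &\quad+\frac{B'(-1)}{q-1}\sum_{\chi\lambda=\overline{B}\,\overline{B'}}\binom{\overline{A}}{\chi}\binom{\overline{A'}}{\lambda}\chi(x)\lambda(-y), \end{align*} where in the first sum $\chi$ and $\lambda$ each range over all multiplicative characters of $\mathbb{F}_q^*$, and the second sum is over all pairs $(\chi,\lambda)$ of multiplicative characters of $\mathbb{F}_q^*$ with $\chi\lambda=\overline{B}\,\overline{B'}$.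
   Context: $\mathbb{F}_q$ is the finite field with $q$ elements. Characters are complex-valued multiplicative characters of $\mathbb{F}_q^*$; every character $\chi$, including the trivial character $\varepsilon$, is extended to $\mathbb{F}_q$ by $\chi(0)=0$. $\overline{\chi}$ is the inverse of $\chi$; juxtaposition of characters is their product. For characters $\chi,\lambda$ the Jacobi sum is $J(\chi,\lambda)=\sum_{u\in\mathbb{F}_q}\chi(u)\lambda(1-u)$, and the binomial coefficient of characters $A,B$ is $\binom{A}{B}=B(-1)J(A,\overline{B})$ (no factor $1/q$). The finite field Appell series $F_3$ is $$F_{3}(A,A';B,B';C;x,y)=\varepsilon(xy)\,BB'(-1)\sum_{u,v\in\mathbb{F}_q}B(u)\,B'(v)\,C\overline{B}\,\overline{B'}(1-u-v)\,\overline{A}(1-ux)\,\overline{A'}(1-vy),$$ where $BB'(-1)$ means $(BB')(-1)$ and $C\overline{B}\,\overline{B'}(1-u-v)$ means $(C\overline{B}\,\overline{B'})(1-u-v)$. *)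

(* Defs.v *)
From HB Require Import structures.
From mathcomp Require Import all_boot all_order all_algebra all_fingroup all_solvable all_field.

Set Implicit Arguments.
Unset Strict Implicit.
Unset Printing Implicit Defensive.

Import GRing.Theory Num.Theory.

Local Open Scope ring_scope.

Section MultiplicativeCharacters.

Variables (F : finFieldType) (K : numClosedFieldType).

Definition is_mchar (f : {ffun {unit F} -> K}) : bool :=
  (f 1%g == 1) && [forall u, forall v, f (u * v)%g == f u * f v].

Record mchar := MChar { mchar_fun : {ffun {unit F} -> K}; _ : is_mchar mchar_fun }.

HB.instance Definition _ := [isSub for mchar_fun].
HB.instance Definition _ := [Choice of mchar by <:].

Implicit Types chi lambda : mchar.

Lemma mchar_fun1 chi : mchar_fun chi 1%g = 1.
Proof. by case: chi => f /= /andP[/eqP]. Qed.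

Lemma mchar_funM chi u v :
  mchar_fun chi (u * v)%g = mchar_fun chi u * mchar_fun chi v.
Proof. by case: chi => f /= /andP[_ /forallP/(_ u)/forallP/(_ v)/eqP]. Qed.

Lemma mchar_funX chi u n : mchar_fun chi (u ^+ n)%g = mchar_fun chi u ^+ n.
Proof.
by elim: n => [|n IHn]; rewrite ?mchar_fun1 // expgS exprS mchar_funM IHn.
Qed.

Lemma mchar_fun_neq0 chi u : mchar_fun chi u != 0.
Proof.
apply/eqP => h; have := mchar_funM chi u u^-1%g.
by rewrite mulgV mchar_fun1 h mul0r => /eqP; rewrite oner_eq0.
Qed.

Lemma is_mcharP (f : {ffun {unit F} -> K}) :
  f 1%g = 1 -> (forall u v, f (u * v)%g = f u * f v) -> is_mchar f.
Proof.
move=> f1 fM; rewrite /is_mchar f1 eqxx.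
by apply/forallP => u; apply/forallP => v; rewrite fM.
Qed.

(* Values of characters are roots of 'X^#|{: {unit F}}| - 1, which splits over K,
   so there are finitely many characters. *)
Definition mchar_roots : seq K :=
  sval (closed_field_poly_normal ('X^#|{: {unit F}}| - 1 : {poly K})).

Lemma mchar_fun_root chi u : mchar_fun chi u \in mchar_roots.
Proof.
rewrite /mchar_roots; case: closed_field_poly_normal => r /= def_p.
have n_gt0 : (0 < #|{: {unit F}}|)%N by rewrite -cardsT cardG_gt0.
have lc1 : lead_coef ('X^#|{: {unit F}}| - 1 : {poly K}) = 1.
  by apply/eqP; rewrite -monicE monicXnsubC.
rewrite -root_prod_XsubC; rewrite lc1 scale1r in def_p; rewrite -def_p.
rewrite rootE !hornerE -mchar_funX.
by rewrite -cardsT (expg_cardG (in_setT u)) mchar_fun1 subrr.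
Qed.

Definition mchar_code chi : {ffun {unit F} -> seq_sub mchar_roots} :=
  [ffun u => SeqSub (mchar_fun_root chi u)].

Definition mchar_decode (c : {ffun {unit F} -> seq_sub mchar_roots}) :
  option mchar := insub [ffun u => val (c u)].

Lemma mchar_codeK : pcancel mchar_code mchar_decode.
Proof.
move=> chi; rewrite /mchar_decode.
have -> : [ffun u => val (mchar_code chi u)] = mchar_fun chi.
  by apply/ffunP => u; rewrite !ffunE.
exact: valK.
Qed.

HB.instance Definition _ : isCountable mchar := PCanIsCountable mchar_codeK.
HB.instance Definition _ : isFinite mchar := PCanIsFinite mchar_codeK.

Lemma mchar_one_subproof : is_mchar [ffun=> 1].
Proof. by apply: is_mcharP => [|u v]; rewrite !ffunE ?mulr1. Qed.

Lemma mchar_mul_subproof chi lambda :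
  is_mchar [ffun u => mchar_fun chi u * mchar_fun lambda u].
Proof.
apply: is_mcharP => [|u v]; rewrite !ffunE ?mchar_fun1 ?mulr1 //.
by rewrite !mchar_funM mulrACA.
Qed.

Lemma mchar_inv_subproof chi : is_mchar [ffun u => (mchar_fun chi u)^-1].
Proof.
apply: is_mcharP => [|u v]; rewrite !ffunE ?mchar_fun1 ?invr1 //.
by rewrite mchar_funM invfM.
Qed.

Definition mchar_one := MChar mchar_one_subproof.
Definition mchar_mul chi lambda := MChar (mchar_mul_subproof chi lambda).
Definition mchar_inv chi := MChar (mchar_inv_subproof chi).

Lemma mchar_mulA : associative mchar_mul.
Proof. by move=> a b c; apply/val_inj/ffunP => u; rewrite !ffunE mulrA. Qed.

Lemma mchar_mul1 : left_id mchar_one mchar_mul.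
Proof. by move=> a; apply/val_inj/ffunP => u; rewrite !ffunE mul1r. Qed.

Lemma mchar_mulV : left_inverse mchar_one mchar_inv mchar_mul.
Proof.
move=> a; apply/val_inj/ffunP => u.
by rewrite !ffunE mulVf ?mchar_fun_neq0.
Qed.

HB.instance Definition _ :=
  Finite_isGroup.Build mchar mchar_mulA mchar_mul1 mchar_mulV.

(* Every character, the trivial one included, vanishes at 0. *)
Definition mchar_ext chi (x : F) : K := oapp (mchar_fun chi) 0 (insub x).

End MultiplicativeCharacters.

Coercion mchar_ext : mchar >-> Funclass.

Section AppellSeries.

Variables (F : finFieldType) (K : numClosedFieldType).

Implicit Types A B C chi lambda : mchar F K.

Definition jacobi_sum chi lambda : K := \sum_(u : F) chi u * lambda (1 - u).

(* No factor 1 / #|F|, unlike Greene's normalization. *)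
Definition mchar_binom A B : K := B (-1) * jacobi_sum A B^-1%g.

Definition appell_F3 A A' B B' C (x y : F) : K :=
  (1%g : mchar F K) (x * y) * (B * B')%g (-1) *
  \sum_(u : F) \sum_(v : F)
    B u * B' v * (C * B^-1 * B'^-1)%g (1 - u - v)
      * A^-1%g (1 - u * x) * A'^-1%g (1 - v * y).

End AppellSeries.

(* Main.v *)
Require Import Defs.
From mathcomp Require Import all_boot all_order all_algebra all_fingroup all_solvable all_field.
From mathcomp Require Import reals complex.
From mathcomp Require Import ring.

Set Implicit Arguments.
Unset Strict Implicit.
Unset Printing Implicit Defensive.

Import GRing.Theory Num.Theory.

Local Open Scope ring_scope.

(** The identity is Fourier analysis on the finite abelian group of units of
    [F].  If [x] or [y] is zero, every term of both sides vanishes, since all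
    characters vanish at 0.  Otherwise, orthogonality of characters gives the
    finite field binomial theorem
    [A (1 - t) = (q - 1)^-1 * \sum_chi mchar_binom A chi * chi (- t)] for
    [t != 0] ([mchar_binomial_theorem]).  Applied to [A^-1 (1 - u x)] and
    [A'^-1 (1 - v y)] inside the series, where the terms with [u = 0] or
    [v = 0] are killed by [B u] and [B' v], it turns the series into a double
    sum over characters whose coefficients are the two-variable Jacobi sums
    [\sum_u \sum_v P u * Q v * D (1 - u - v)] with [P = B chi],
    [Q = B' lambda] and [D = C B^-1 B'^-1] ([appell_F3_fourier]).

    The substitution [v = - u w] separates the variables in such a sum.  For
    [w != 1] the sum over [u] is a rescaled Jacobi sum of [D] and [P Q]; for
    [w = 1] the argument of [D] is identically 1 and what is left is the sum
    of all values of [P Q], which is [q - 1] if [P Q] is trivial and 0 otherwise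
    ([double_jacobi_sum]).  The first part is a product of two Jacobi sums, and
    becomes the product of the two binomial coefficients that involve [B] and [B'] through the
    reflection [jacobi_sum A (A B)^-1 = A (-1) * jacobi_sum A B].  The
    exceptional part is supported on [chi lambda = B^-1 B'^-1], and produces the
    second sum of the theorem.

    Orthogonality on the dual side rests on characters separating the units:
    the unit group is cyclic, so a primitive root of unity of the right order
    yields an injective character. *)

(** * Characters of the unit group and their extension to the field *)

(** In characteristic 0 the polynomial ['X^n - 1] is separable, so it has [n]
    distinct roots, and these form a cyclic group. *)
Lemma exists_primitive_root (K : numClosedFieldType) (n : nat) :
  (0 < n)%N -> exists z : K, n.-primitive_root z.
Proof.
move=> n_gt0; have [s] := closed_field_poly_normal ('X^n - 1 : {poly K}).
rewrite (monicP (monicXnsubC _ n_gt0)) scale1r => split_s.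
have uniq_s : uniq s.
  rewrite -separable_prod_XsubC -split_s.
  by rewrite cyclotomic.separable_Xn_sub_1 // pnatr_eq0 -lt0n.
have size_s : size s = n.
  by apply: succn_inj; rewrite -(size_prod_XsubC s id) -split_s size_XnsubC.
have root_s : all n.-unity_root s.
  by apply/allP => z; rewrite -root_prod_XsubC -split_s.
have /hasP[z _ z_prim] : has n.-primitive_root s.
  by rewrite has_prim_root ?size_s.
by exists z.
Qed.

Section CharacterSums.

Variables (F : finFieldType) (K : numClosedFieldType).

Implicit Types A B C D P Q chi lambda psi : mchar F K.

Lemma mchar_val chi (u : {unit F}) : chi (val u) = mchar_fun chi u.
Proof. by rewrite /mchar_ext valK. Qed.

Lemma mchar0 chi : chi 0 = 0.
Proof. by rewrite /mchar_ext insubF // unitr0. Qed.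

(** Case analysis matching the definition of the extension by zero: it reduces
    an identity between characters to the point 0 and to the group of units. *)
Variant field_elt_spec : F -> Prop :=
  | FieldElt0 : field_elt_spec 0
  | FieldEltUnit (u : {unit F}) : field_elt_spec (val u).

Lemma field_eltP x : field_elt_spec x.
Proof.
have [->|x_neq0] := eqVneq x 0; first by constructor.
have x_unit : x \is a GRing.unit by rewrite unitfE.
by rewrite -[x]/(val (FinRing.unit F x_unit)); constructor.
Qed.

Lemma mchar1 chi : chi 1 = 1.
Proof. by rewrite -[1]/(val (1%g : {unit F})) mchar_val mchar_fun1. Qed.

Lemma mcharM chi x y : chi (x * y) = chi x * chi y.
Proof.
case: (field_eltP x) => [|u]; first by rewrite !(mul0r, mchar0).
case: (field_eltP y) => [|v]; first by rewrite !(mulr0, mchar0).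
rewrite -[val u * val v]/(val (u * v)%g).
by rewrite !mchar_val mchar_funM.
Qed.

Lemma mchar_eq0 chi x : (chi x == 0) = (x == 0).
Proof.
case: (field_eltP x) => [|u]; first by rewrite mchar0 !eqxx.
rewrite mchar_val (negPf (mchar_fun_neq0 chi u)); apply/esym/negbTE.
by rewrite -unitfE (valP u).
Qed.

Lemma mcharV chi x : chi x^-1 = (chi x)^-1.
Proof.
have [->|x_neq0] := eqVneq x 0; first by rewrite invr0 mchar0 invr0.
have chix_neq0 : chi x != 0 by rewrite mchar_eq0.
by apply: (mulIf chix_neq0); rewrite mulVf // -mcharM mulVf // mchar1.
Qed.

Lemma mchar_mulE chi lambda x : (chi * lambda)%g x = chi x * lambda x.
Proof.
case: (field_eltP x) => [|u]; first by rewrite !mchar0 mul0r.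
by rewrite !mchar_val ffunE.
Qed.

Lemma mchar_invE chi x : (chi^-1)%g x = (chi x)^-1.
Proof.
case: (field_eltP x) => [|u]; first by rewrite !mchar0 invr0.
by rewrite !mchar_val ffunE.
Qed.

Lemma mchar_oneE x : x != 0 -> (1%g : mchar F K) x = 1.
Proof.
case: (field_eltP x) => [|u]; first by rewrite eqxx.
by rewrite mchar_val ffunE.
Qed.

Lemma eq_mchar chi lambda :
  (forall x, x != 0 -> chi x = lambda x) -> chi = lambda.
Proof.
move=> eq_chi; apply/val_inj/ffunP => u.
by rewrite -!mchar_val eq_chi // -unitfE (valP u).
Qed.

Lemma mchar_sqrN1 chi : chi (-1) * chi (-1) = 1.
Proof. by rewrite -mcharM mulrNN mulr1 mchar1. Qed.

Lemma mcharN chi x : chi (- x) = chi (-1) * chi x.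
Proof. by rewrite -mcharM mulN1r. Qed.

Lemma mcharVN1 chi : (chi (-1))^-1 = chi (-1).
Proof. by rewrite -mcharV invrN invr1. Qed.

(** * Orthogonality relations *)

(** Sending a generator of the cyclic unit group to a primitive root of unity
    of the same order [#[g]%g] defines an injective character; discrete
    logarithms are only determined modulo that order, which is exactly what
    powers of the root see. *)
Lemma exists_faithful_mchar :
  exists psi : mchar F K, injective (mchar_fun psi).
Proof.
have /cyclicP[g genF] : cyclic [set: {unit F}] by exact: field_unit_group_cyclic.
have [z z_prim] := exists_primitive_root K (order_gt0 g).
have powg (u : {unit F}) : exists i, u == (g ^+ i)%g.
  have : u \in <[g]>%g by rewrite -genF inE.
  by case/cycleP => i ->; exists i.
pose log u := xchoose (powg u).
have logK u : (g ^+ log u)%g = u by rewrite -(eqP (xchooseP (powg u))).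
have eq_pow i j : ((g ^+ i)%g == (g ^+ j)%g) = (z ^+ i == z ^+ j).
  by rewrite eq_expg_mod_order (eq_prim_root_expr z_prim).
have psi_mchar : is_mchar [ffun u => z ^+ log u].
  apply: is_mcharP => [|u v]; rewrite !ffunE.
    by rewrite -(expr0 z); apply/eqP; rewrite -eq_pow logK expg0.
  by rewrite -exprD; apply/eqP; rewrite -eq_pow expgD !logK.
exists (MChar psi_mchar) => u v; rewrite /= !ffunE => /eqP.
by rewrite -eq_pow !logK => /eqP.
Qed.

(** If [chi u != 1] for a unit [u], the sum is unchanged by the substitution
    [x -> u x] and is at the same time multiplied by [chi u]; hence it is 0. *)
Lemma sum_mchar_values chi :
  \sum_(x : F) chi x = (chi == 1%g)%:R * (#|F|%:R - 1).
Proof.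
have [->|chi_neq1] := eqVneq chi 1%g.
  rewrite (bigD1 0) //= mchar0 add0r mul1r.
  rewrite (eq_bigr (fun=> 1)) => [|x]; last exact: mchar_oneE.
  by rewrite sumr_const cardC1 -subn1 natrB // ltnW ?card_finNzRing_gt1.
rewrite mul0r.
have [u chiu_neq1] : exists u, mchar_fun chi u != 1.
  apply/existsP; apply: contraNT chi_neq1 => /existsPn chi1.
  by apply/eqP/val_inj/ffunP => u; rewrite ffunE; apply/eqP/negPn/chi1.
have u_neq0 : val u != 0 by rewrite -unitfE (valP u).
have invariant : chi (val u) * \sum_x chi x = \sum_x chi x.
  rewrite mulr_sumr [RHS](reindex_inj (mulfI u_neq0)) /=.
  by apply: eq_bigr => x _; rewrite mcharM.
move/eqP: invariant; rewrite -subr_eq0 -[X in _ - X]mul1r -mulrBl mulf_eq0.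
by rewrite mchar_val subr_eq0 (negPf chiu_neq1) => /eqP.
Qed.

(** The same translation argument in the dual group: multiplying by an
    injective character [psi] permutes the characters and multiplies the sum by
    [psi x != 1]. *)
Lemma sum_mchars_vanish (x : F) : x != 1 -> \sum_chi (chi : mchar F K) x = 0.
Proof.
case: (field_eltP x) => [_|u u_neq1]; first by rewrite big1 // => chi; rewrite mchar0.
have [psi psi_inj] := exists_faithful_mchar.
have psiu_neq1 : psi (val u) != 1.
  by rewrite mchar_val -(mchar_fun1 psi) (inj_eq psi_inj); apply: contra u_neq1 => /eqP->.
have invariant : psi (val u) * \sum_chi (chi : mchar F K) (val u)
    = \sum_chi (chi : mchar F K) (val u).
  rewrite mulr_sumr [RHS](reindex_inj (mulgI psi)) /=.
  by apply: eq_bigr => chi _; rewrite mchar_mulE.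
move/eqP: invariant; rewrite -subr_eq0 -[X in _ - X]mul1r -mulrBl mulf_eq0.
by rewrite subr_eq0 (negPf psiu_neq1) => /eqP.
Qed.

(** At [x = 1] the claim is that there are [q - 1] characters.  They are counted
    by summing [chi y] over all [chi] and [y] in the two possible orders: one
    order leaves only [y = 1], the other only the trivial character. *)
Lemma sum_mchars x :
  \sum_chi (chi : mchar F K) x = (x == 1)%:R * (#|F|%:R - 1).
Proof.
have [->|/sum_mchars_vanish ->] := eqVneq x 1; last by rewrite mul0r.
rewrite mul1r.
transitivity (\sum_(y : F) \sum_chi (chi : mchar F K) y).
  by rewrite [RHS](bigD1 1) //= [X in _ + X]big1 ?addr0 // => y /sum_mchars_vanish.
rewrite exchange_big /= (bigD1 1%g) //= sum_mchar_values eqxx mul1r.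
rewrite big1 ?addr0 // => chi /negPf chi_neq1.
by rewrite sum_mchar_values chi_neq1 mul0r.
Qed.

Lemma field_card_pred_neq0 : #|F|%:R - 1 != 0 :> K.
Proof. by rewrite subr_eq0 (eqr_nat K _ 1) neq_ltn card_finNzRing_gt1 orbT. Qed.

(** * The binomial theorem *)

(** Fourier inversion.  The sign [chi (-1)] in the binomial coefficient cancels
    the one in [chi (- t)], so the right side is
    [\sum_u A u * \sum_chi chi (t / (1 - u))], in which only [u = 1 - t]
    survives. *)
Lemma mchar_binomial_theorem A t : t != 0 ->
  A (1 - t) = (#|F|%:R - 1)^-1 * \sum_chi mchar_binom A chi * chi (- t).
Proof.
move=> t_neq0; apply: (mulfI field_card_pred_neq0).
rewrite mulrA divff ?field_card_pred_neq0 // mul1r.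
transitivity (\sum_u A u * \sum_chi (chi : mchar F K) (t / (1 - u))).
  rewrite (bigD1 (1 - t)) //= subKr divff // sum_mchars eqxx mul1r.
  rewrite big1 ?addr0 1?mulrC // => u u_neq.
  rewrite sum_mchars; case: eqP; rewrite ?mul0r ?mulr0 // => tu1.
  case/eqP: u_neq; have d_neq0 : 1 - u != 0.
    by apply/eqP => d0; move/eqP: tu1; rewrite d0 invr0 mulr0 eq_sym oner_eq0.
  by rewrite -[t](divfK d_neq0) tu1 mul1r; ring.
under eq_bigr do rewrite mulr_sumr.
rewrite exchange_big; apply: eq_bigr => chi _ /=.
rewrite /mchar_binom /jacobi_sum (mcharN chi t) mulrACA mchar_sqrN1 mul1r mulrC.
rewrite mulr_sumr; apply: eq_bigr => u _.
by rewrite mchar_invE mcharM mcharV mulrCA.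
Qed.

(** The binomial theorem excludes [t = 0], but a factor [B u] with [B 0 = 0]
    absorbs this exception. *)
Lemma mchar_binomial_weighted A B x u : x != 0 ->
  B u * A (1 - u * x)
    = (#|F|%:R - 1)^-1 *
        \sum_chi mchar_binom A chi * chi (- x) * (B * chi)%g u.
Proof.
move=> x_neq0; have [->|u_neq0] := eqVneq u 0.
  by rewrite mchar0 mul0r big1 ?mulr0 // => chi _; rewrite mchar0 mulr0.
rewrite mchar_binomial_theorem ?mulf_neq0 // mulrCA mulr_sumr.
congr (_ * _); apply: eq_bigr => chi _.
by rewrite mchar_mulE -mulrN mcharM; ring.
Qed.

(** * Jacobi sums in one and two variables *)

Lemma jacobi_sumC A B : jacobi_sum A B = jacobi_sum B A.
Proof.
rewrite /jacobi_sum (reindex_inj (inj_comp (addrI 1) oppr_inj)) /=.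
by apply: eq_bigr => u _; rewrite mulrC subKr.
Qed.

(** Substitute [u -> u / (u - 1)], for which [1 - u] becomes [1 / (1 - u)]. *)
Lemma jacobi_sum_reflect A B :
  jacobi_sum A (A * B)^-1%g = A (-1) * jacobi_sum A B.
Proof.
(* [u / (u - 1)] is an involution away from 1; fixing 1 makes it a permutation
   of the field, and both summands vanish there. *)
pose h (u : F) := if u == 1 then 1 else u / (u - 1).
have hK : involutive h.
  move=> u; rewrite /h; have [->|u_neq1] := eqVneq u 1; first by rewrite eqxx.
  have d_neq0 : u - 1 != 0 by rewrite subr_eq0.
  have -> : u / (u - 1) = 1 + (u - 1)^-1 by field.
  have -> : (1 + (u - 1)^-1 == 1) = false.
    by rewrite -subr_eq0 addrAC subrr add0r invr_eq0 (negPf d_neq0).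
  by rewrite addrAC subrr add0r invrK; field.
rewrite /jacobi_sum mulr_sumr [RHS](reindex_inj (inv_inj hK)) /=.
apply: eq_bigr => u _; rewrite /h.
have [->|u_neq1] := eqVneq u 1; first by rewrite subrr !mchar0 !mulr0.
have d_neq0 : 1 - u != 0 by rewrite subr_eq0 eq_sym.
have d'_neq0 : u - 1 != 0 by rewrite subr_eq0.
have -> : 1 - u / (u - 1) = (1 - u)^-1 by field; rewrite d_neq0.
have -> : u / (u - 1) = -1 * u / (1 - u) by field; rewrite d_neq0.
rewrite !mchar_invE !mchar_mulE !mcharM !mcharV invfM !mulrA mchar_sqrN1 mul1r.
by [].
Qed.

(** For [c != 0] rescaling [u] gives a Jacobi sum, while for [c = 0] the factor
    [D 1 = 1] drops out.  Since [(P 0)^-1 = 0], one formula covers both cases. *)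
Lemma sum_mchar_dilate D P c :
  \sum_(u : F) P u * D (1 - u * c)
    = (P c)^-1 * jacobi_sum D P + (c == 0)%:R * ((P == 1%g)%:R * (#|F|%:R - 1)).
Proof.
have [->|c_neq0] := eqVneq c 0.
  rewrite mchar0 invr0 mul0r add0r mul1r -sum_mchar_values.
  by apply: eq_bigr => u _; rewrite mulr0 subr0 mchar1 mulr1.
rewrite mul0r addr0 jacobi_sumC /jacobi_sum mulr_sumr.
rewrite [RHS](reindex_inj (mulIf c_neq0)) /=; apply: eq_bigr => u _.
have Pc_neq0 : P c != 0 by rewrite mchar_eq0.
by rewrite mcharM; field.
Qed.

(** After [v = - u w] one has [1 - u - v = 1 - u (1 - w)], so that the sum over
    [u] is the previous lemma with [c = 1 - w].  The correction supported at
    [w = 1] is what eventually becomes the second sum of the theorem. *)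
Lemma double_jacobi_sum D P Q :
  \sum_(u : F) \sum_(v : F) P u * Q v * D (1 - u - v)
    = Q (-1) * (jacobi_sum (P * Q)^-1%g Q * jacobi_sum D (P * Q)%g
                + (P * Q == 1)%g%:R * (#|F|%:R - 1)).
Proof.
transitivity (Q (-1) * \sum_(w : F) Q w *
                \sum_(u : F) (P * Q)%g u * D (1 - u * (1 - w))).
  under [in RHS]eq_bigr do rewrite mulr_sumr.
  rewrite [in RHS]exchange_big mulr_sumr; apply: eq_bigr => u _ /=.
  have [->|u_neq0] := eqVneq u 0.
    rewrite big1 => [|v _]; last by rewrite mchar0 !mul0r.
    by rewrite big1 ?mulr0 // => w _; rewrite mchar0 mul0r mulr0.
  have Nu_neq0 : - u != 0 by rewrite oppr_eq0.
  rewrite (reindex_inj (mulfI Nu_neq0)) mulr_sumr /=; apply: eq_bigr => w _.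
  have -> : 1 - u - - u * w = 1 - u * (1 - w) by ring.
  by rewrite mchar_mulE mulNr mcharN mcharM; ring.
congr (_ * _).
under eq_bigr do rewrite sum_mchar_dilate mulrDr.
rewrite big_split /=; congr (_ + _).
  rewrite (jacobi_sumC (P * Q)^-1%g) [jacobi_sum Q _]/jacobi_sum mulr_suml; apply: eq_bigr => w _.
  by rewrite mchar_invE mulrA.
rewrite (bigD1 1) //= subrr eqxx mchar1 !mul1r big1 ?addr0 // => w w_neq1.
by rewrite subr_eq0 eq_sym (negPf w_neq1) mul0r mulr0.
Qed.

(** In terms of [P = B chi], [Q = B' lambda] and [D = C B^-1 B'^-1], the two
    binomial coefficients are [mchar_binom D (D P Q)] and
    [mchar_binom (P Q)^-1 Q^-1].  The reflection formula turns the former into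
    [(P Q) (-1) * jacobi_sum D (P Q)], and the remaining signs agree because
    each is a square root of 1. *)
Lemma double_jacobi_sum_binom B B' C chi lambda :
  (B * B')%g (-1) * (chi (-1) * lambda (-1)) *
    \sum_(u : F) \sum_(v : F)
      (B * chi)%g u * (B' * lambda)%g v * (C * B^-1 * B'^-1)%g (1 - u - v)
  = mchar_binom (C * B^-1 * B'^-1)%g (C * chi * lambda)%g
      * mchar_binom (B^-1 * B'^-1 * chi^-1 * lambda^-1)%g (B'^-1 * lambda^-1)%g
    + (chi * lambda == B^-1 * B'^-1)%g%:R
        * ((#|F|%:R - 1) * (B' (-1) * lambda (-1))).
Proof.
set D := (C * B^-1 * B'^-1)%g; set P := (B * chi)%g; set Q := (B' * lambda)%g.
have eqD : (C * chi * lambda = D * (P * Q))%g.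
  apply: eq_mchar => u u_neq0.
  rewrite /D /P /Q !(mchar_mulE, mchar_invE, mchar_oneE) //.
  by field; rewrite !mchar_eq0 u_neq0.
have eqPQ : (B^-1 * B'^-1 * chi^-1 * lambda^-1 = (P * Q)^-1)%g.
  apply: eq_mchar => u u_neq0.
  rewrite /D /P /Q !(mchar_mulE, mchar_invE, mchar_oneE) //.
  by field; rewrite !mchar_eq0 u_neq0.
have eqQ : (B'^-1 * lambda^-1 = Q^-1)%g.
  apply: eq_mchar => u u_neq0.
  rewrite /D /P /Q !(mchar_mulE, mchar_invE, mchar_oneE) //.
  by field; rewrite !mchar_eq0 u_neq0.
have eq1 : (chi * lambda == B^-1 * B'^-1)%g = (P * Q == 1)%g.
  rewrite eq_mulgV1; congr (_ == _).
  apply: eq_mchar => u u_neq0.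
  rewrite /D /P /Q !(mchar_mulE, mchar_invE, mchar_oneE) //.
  by field; rewrite !mchar_eq0 u_neq0.
rewrite eqD eqPQ eqQ eq1 double_jacobi_sum.
rewrite /mchar_binom invgK jacobi_sum_reflect.
have -> : (B * B')%g (-1) * (chi (-1) * lambda (-1)) = P (-1) * Q (-1).
  by rewrite /P /Q !mchar_mulE; ring.
have -> : B' (-1) * lambda (-1) = Q (-1) by rewrite /Q !mchar_mulE.
rewrite (mchar_mulE D) (mchar_mulE P) (mchar_invE Q) mcharVN1.
set X := jacobi_sum _ Q; set Y := jacobi_sum D _; set q1 : K := #|F|%:R - 1.
set delta : K := (_ == _)%:R.
(* Where the exceptional term is present, [P Q] is trivial, so the signs
   [P (-1)] and [Q (-1)] coincide. *)
have deltaPQ : delta * P (-1) = delta * Q (-1).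
  rewrite /delta; case: eqP => [PQ1|_]; last by rewrite !mul0r.
  have pq1 : P (-1) * Q (-1) = 1.
    by rewrite -mchar_mulE PQ1 mchar_oneE // oppr_eq0 oner_eq0.
  by rewrite -[P (-1)]mulr1 -(mchar_sqrN1 Q) (mulrA (P _)) pq1 mul1r.
transitivity (Q (-1) * Q (-1) * (P (-1) * (X * Y) + delta * P (-1) * q1)).
  by ring.
rewrite deltaPQ mchar_sqrN1 mul1r.
transitivity (D (-1) * D (-1) * (Q (-1) * Q (-1)) * P (-1) * (X * Y)
              + delta * Q (-1) * q1); last by ring.
by rewrite !mchar_sqrN1 !mul1r.
Qed.

(** * Expansion of the Appell series *)

(** Each of the factors [A^-1 (1 - u x)] and [A'^-1 (1 - v y)] is replaced by
    its binomial expansion; only [u] and [v] then remain inside the double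
    Jacobi sum, and [x] and [y] are carried by [chi] and [lambda]. *)
Lemma appell_F3_fourier A A' B B' C x y : x != 0 -> y != 0 ->
  appell_F3 A A' B B' C x y =
    (#|F|%:R - 1)^-1 ^+ 2 * \sum_chi \sum_lambda
      mchar_binom A^-1%g chi * mchar_binom A'^-1%g lambda
        * (chi x * lambda y)
        * ((B * B')%g (-1) * (chi (-1) * lambda (-1)) *
            \sum_(u : F) \sum_(v : F)
              (B * chi)%g u * (B' * lambda)%g v
                * (C * B^-1 * B'^-1)%g (1 - u - v)).
Proof.
move=> x_neq0 y_neq0; rewrite /appell_F3 mchar_oneE ?mulf_neq0 // mul1r.
set D := (C * B^-1 * B'^-1)%g; set N : K := #|F|%:R - 1.
pose b chi := mchar_binom A^-1%g chi; pose b' lambda := mchar_binom A'^-1%g lambda.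
transitivity ((B * B')%g (-1) * \sum_(u : F) \sum_(v : F)
   \sum_chi \sum_lambda N^-1 ^+ 2 *
     (b chi * b' lambda * (chi x * lambda y) * (chi (-1) * lambda (-1)) *
       ((B * chi)%g u * (B' * lambda)%g v * D (1 - u - v)))).
  congr (_ * _); apply: eq_bigr => u _; apply: eq_bigr => v _.
  rewrite [LHS](_ : _ = (B u * A^-1%g (1 - u * x)) *
            (B' v * A'^-1%g (1 - v * y)) * D (1 - u - v)); last by ring.
  rewrite !mchar_binomial_weighted // -/N mulrACA -expr2 big_distrlr /=.
  rewrite -mulrA mulr_suml mulr_sumr; apply: eq_bigr => chi _.
  rewrite mulr_suml mulr_sumr; apply: eq_bigr => lambda _.
  by rewrite (mcharN chi x) (mcharN lambda y) /b /b'; ring.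
rewrite pair_big /=; under eq_bigr do rewrite pair_big /=.
rewrite exchange_big [in RHS]pair_big /= !mulr_sumr.
apply: eq_bigr => c _; rewrite [in RHS]pair_big /= !mulr_sumr.
by apply: eq_bigr => w _; rewrite /b /b'; ring.
Qed.

End CharacterSums.

Theorem theorem2p3 (F : finFieldType) (R : realType)
    (A A' B B' C : mchar F R[i]) (x y : F) :
  appell_F3 A A' B B' C x y =
    1 / (#|F|%:R - 1) ^+ 2 *
      (\sum_(chi : mchar F R[i]) \sum_(lambda : mchar F R[i])
         mchar_binom A^-1%g chi * mchar_binom A'^-1%g lambda
           * mchar_binom (C * B^-1 * B'^-1)%g (C * chi * lambda)%g
           * mchar_binom (B^-1 * B'^-1 * chi^-1 * lambda^-1)%g
                         (B'^-1 * lambda^-1)%g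
           * chi x * lambda y)
    + B' (-1) / (#|F|%:R - 1) *
      (\sum_(p : mchar F R[i] * mchar F R[i] | (p.1 * p.2 == B^-1 * B'^-1)%g)
         mchar_binom A^-1%g p.1 * mchar_binom A'^-1%g p.2
           * p.1 x * p.2 (- y)).
Proof.
have [->|x_neq0] := eqVneq x 0.
  rewrite /appell_F3 !mul0r mchar0 !mul0r big1 => [|chi _].
    by rewrite mulr0 add0r big1 ?mulr0 // => p _; rewrite mchar0 mulr0 mul0r.
  by rewrite big1 // => lambda _; rewrite mchar0 mulr0 mul0r.
have [->|y_neq0] := eqVneq y 0.
  rewrite /appell_F3 !mulr0 mchar0 !mul0r big1 => [|chi _].
    by rewrite mulr0 add0r oppr0 big1 ?mulr0 // => p _; rewrite mchar0 mulr0.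
  by rewrite big1 // => lambda _; rewrite mchar0 mulr0.
rewrite appell_F3_fourier //.
have N_neq0 := field_card_pred_neq0 F R[i].
under eq_bigr do under eq_bigr do rewrite double_jacobi_sum_binom mulrDr.
under eq_bigr do rewrite big_split /=.
rewrite big_split mulrDr /=; congr (_ + _).
  rewrite exprVn mul1r; congr (_ * _); apply: eq_bigr => chi _.
  by apply: eq_bigr => lambda _; rewrite !mulrA; ring.
(* The Kronecker delta left by each double Jacobi sum cuts the sum over all
   pairs down to those with [chi * lambda = B^-1 * B'^-1]. *)
rewrite pair_big /= [in RHS]big_mkcond /= !mulr_sumr; apply: eq_bigr => p _.
rewrite (mcharN p.2 y); case: ifP => _; last by rewrite mul0r !mulr0.
by rewrite mul1r; field.
Qed.
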